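(* Let $A$ and $B$ be simple unital C*-algebras, let $\varphi\colon GL(A)\to GL(B)$ be an isomorphism of abstract groups, and let $\theta\colon \mathcal{I}(A)\to\mathcal{I}(B)$ be the bijection determined by $1-2\theta(e)=\varphi(1-2e)$ for $e\in\mathcal{I}(A)$. Suppose that $A$ is oddly decomposable. Then $\varphi$ induces an orthoisomorphism between $\mathcal{I}(A)$ and $\mathcal{I}(B)$ which preserves similarity of idempotents. Precisely: there exist disjoint (possibly empty) sets $\mathcal{I}_o,\mathcal{I}_{\bar o}$ with $\mathcal{I}_o\cup \mathcal{I}_{\bar o}=\mathcal{I}(A)\setminus\{0,1\}$ such that the map $\tilde\theta\colon\mathcal{I}(A)\to\mathcal{I}(B)$ defined by $\tilde\theta(e)=\theta(e)$ if $e\in\mathcal{I}_o$, $\tilde\theta(e)=1-\theta(e)$ if $e\in\mathcal{I}_{\bar o}$, $\tilde\theta(1)=1$ and $\tilde\theta(0)=0$, is an orthoisomorphism, and $\tilde\theta(e)$ is similar to $\tilde\theta(f)$ whenever $e,f\in\mathcal{I}(A)$ are similar.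
   Context: For a unital C*-algebra $A$, $GL(A)$ denotes the group of invertible elements of $A$, $\mathcal{I}(A)$ the set of idempotents of $A$ (elements with $e^2=e$, not necessarily self-adjoint), and $\widetilde{\mathcal{I}(A)}=\mathcal{I}(A)\setminus\{0,1\}$ the set of non-trivial idempotents. Two or more idempotents are orthogonal if any two of them commute and have product zero. Two idempotents $e,f\in\mathcal{I}(A)$ are similar if $f=ueu^{-1}$ for some $u\in GL(A)$. An orthoisomorphism $\mathcal{I}(A)\to\mathcal{I}(B)$ is a bijective map which preserves orthogonality of commuting idempotents, i.e. maps orthogonal idempotents to orthogonal idempotents. A unital C*-algebra $A$ is oddly decomposable if for every pair of idempotents $e,f\in\widetilde{\mathcal{I}(A)}$ there are an odd integer $n\ge 3$ and $n$ orthogonal idempotents $g_1,\dots,g_n\in\widetilde{\mathcal{I}(A)}$ with $g_1+\dots+g_n=f$, such that each $g_i$ is similar to some $g_i'\in\widetilde{\mathcal{I}(A)}$ with $g_i'e=eg_i'=g_i'\neq e$. *)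

(* Defs.v *)
From HB Require Import structures.
From mathcomp Require Import all_boot all_order all_algebra.
From mathcomp Require Import all_classical all_reals all_analysis.
From mathcomp Require Import complex.
Set Implicit Arguments.
Unset Strict Implicit.
Unset Printing Implicit Defensive.
Import Order.TTheory GRing.Theory Num.Theory.
Import numFieldNormedType.Exports.
Local Open Scope classical_set_scope.
Local Open Scope complex_scope.
Local Open Scope ring_scope.

(* No structure of the library combines a norm with a multiplication on a type
   that is not a number domain: Hierarchy Builder takes Num.NumDomain for the
   join of the two and rejects the combination. So an algebra with a norm is
   declared here as an algebra, and [banach A] is the same carrier with the
   library's structure of normed module.

   The norm takes its values in R[i], as in the library. The axioms force these
   values to be nonnegative for the order of R[i], hence real.

   The carrier of a [unitAlgType] is a nonzero ring in which an inverse function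
   has been chosen; its units are exactly the two-sided invertible elements. *)
HB.mixin Record UnitAlgebra_isNormedAlgebra (R : realType) A
    of GRing.UnitAlgebra R[i] A := {
  anorm : A -> R[i];
  anormD : forall x y : A, anorm (x + y) <= anorm x + anorm y;
  anormZ : forall (a : R[i]) (x : A), anorm (a *: x) = `|a| * anorm x;
  anorm0_eq0 : forall x : A, anorm x = 0 -> x = 0;
  anormM : forall x y : A, anorm (x * y) <= anorm x * anorm y
}.

#[short(type="normedUnitAlgType")]
HB.structure Definition NormedUnitAlgebra (R : realType) :=
  {A of UnitAlgebra_isNormedAlgebra R A & GRing.UnitAlgebra R[i] A}.

Section UnderlyingNormedModule.
Variables (R : realType) (A : normedUnitAlgType R).

Definition banach : Type := A.

HB.instance Definition _ := GRing.Lmodule.copy banach A.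
HB.instance Definition _ := @Lmodule_isNormed.Build (R[i] : numFieldType) banach
  (@anorm R A) (@anormD R A) (@anormZ R A) (@anorm0_eq0 R A).

End UnderlyingNormedModule.

(* [cauchy_cvg_axiom] is the axiom of the library's [completeType]. *)
HB.mixin Record NormedAlgebra_isCStarAlgebra (R : realType) A
    of NormedUnitAlgebra R A := {
  cauchy_cvg_axiom : forall F : set_system (banach A),
    ProperFilter F -> cauchy F -> cvg F;
  star : A -> A;
  starK : involutive star;
  starD : {morph star : x y / x + y};
  starZ : forall (a : R[i]) (x : A), star (a *: x) = a^* *: star x;
  starM : forall x y : A, star (x * y) = star y * star x;
  anorm_star : forall x : A, anorm (star x * x) = anorm x ^+ 2
}.

#[short(type="unitalCStarAlgType")]
HB.structure Definition CStarAlgebra (R : realType) :=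
  {A of NormedAlgebra_isCStarAlgebra R A & NormedUnitAlgebra R A}.

HB.instance Definition _ (R : realType) (A : unitalCStarAlgType R) :=
  Uniform_isComplete.Build (banach A) (@cauchy_cvg_axiom R A).

Definition two_sided_ideal (A : nzRingType) (I : set A) : Prop :=
  [/\ I 0, forall x y, I x -> I y -> I (x + y),
      forall a x, I x -> I (a * x) & forall a x, I x -> I (x * a)].

Definition simple_cstar (R : realType) (A : unitalCStarAlgType R) : Prop :=
  forall I : set A, two_sided_ideal I -> closed (I : set (banach A)) ->
  I = [set 0] \/ I = setT.

Section GeneralLinearGroup.
Variable A : unitRingType.

(* The library's {unit A} is only available for finite rings. *)
Record GL : Type := mkGL { GLval : A; GL_unit : GLval \is a GRing.unit }.

HB.instance Definition _ := [isSub for GLval].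
HB.instance Definition _ := [Choice of GL by <:].

Definition GL1 : GL := mkGL (@unitr1 A).

Lemma GL_mul_subproof (u v : GL) : GLval u * GLval v \is a GRing.unit.
Proof. by rewrite unitrMr GL_unit. Qed.
Definition GL_mul u v : GL := mkGL (GL_mul_subproof u v).

Lemma GL_inv_subproof (u : GL) : (GLval u)^-1 \is a GRing.unit.
Proof. by rewrite unitrV GL_unit. Qed.
Definition GL_inv u : GL := mkGL (GL_inv_subproof u).

Fact GL_mulA : associative GL_mul.
Proof. by move=> u v w; apply/val_inj/mulrA. Qed.
Fact GL_mul1 : left_id GL1 GL_mul.
Proof. by move=> u; apply/val_inj/mul1r. Qed.
Fact GL_mulr1 : right_id GL1 GL_mul.
Proof. by move=> u; apply/val_inj/mulr1. Qed.
Fact GL_mulV : left_inverse GL1 GL_inv GL_mul.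
Proof. by move=> u; apply/val_inj/mulVr/GL_unit. Qed.
Fact GL_mulrV : right_inverse GL1 GL_inv GL_mul.
Proof. by move=> u; apply/val_inj/mulrV/GL_unit. Qed.

HB.instance Definition _ :=
  isGroup.Build GL GL_mulA GL_mul1 GL_mulr1 GL_mulV GL_mulrV.

End GeneralLinearGroup.
Arguments GLval {A} g.

Section Idempotents.
Variable A : unitRingType.

Record idem : Type :=
  mkIdem { idem_val : A; idemE : idem_val * idem_val == idem_val }.

HB.instance Definition _ := [isSub for idem_val].
HB.instance Definition _ := [Choice of idem by <:].

Lemma idemM (e : idem) : val e * val e = val e.
Proof. exact/eqP/idemE. Qed.

Fact idem0_subproof : (0 : A) * 0 == 0. Proof. by rewrite mul0r. Qed.
Definition idem0 : idem := mkIdem idem0_subproof.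

Fact idem1_subproof : (1 : A) * 1 == 1. Proof. by rewrite mul1r. Qed.
Definition idem1 : idem := mkIdem idem1_subproof.

Fact idemC_subproof (e : idem) : (1 - val e) * (1 - val e) == 1 - val e.
Proof. by rewrite mulrBr mulr1 mulrBl mul1r idemM subrr subr0. Qed.
Definition idemC (e : idem) : idem := mkIdem (idemC_subproof e).

Lemma symmetry_sqr (e : idem) : (1 - val e *+ 2) * (1 - val e *+ 2) = 1.
Proof.
rewrite mulrBr mulr1 mulrBl mul1r mulrnAr mulrnAl idemM.
by rewrite opprB [X in _ + (X - _)]mulr2n addrK subrK.
Qed.

Fact symmetry_unit (e : idem) : 1 - val e *+ 2 \is a GRing.unit.
Proof.
by apply/unitrP; exists (1 - val e *+ 2); rewrite symmetry_sqr.
Qed.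
Definition idem_symmetry (e : idem) : GL A := mkGL (symmetry_unit e).

Definition nontrivial_idem : set idem := [set e | e != idem0 /\ e != idem1].

Definition orthogonal_idem (e f : idem) : Prop :=
  val e * val f = val f * val e /\ val e * val f = 0.

Definition similar_idem (e f : idem) : Prop :=
  exists u : GL A, val f = val u * val e * (val u)^-1.

Definition oddly_decomposable : Prop :=
  forall e f : idem, nontrivial_idem e -> nontrivial_idem f ->
  exists (n : nat) (g : 'I_n -> idem),
  [/\ odd n /\ (3 <= n)%N,
      forall i, nontrivial_idem (g i),
      forall i j, i != j -> orthogonal_idem (g i) (g j),
      \sum_(i < n) val (g i) = val f &
      forall i, exists g' : idem,
        [/\ nontrivial_idem g', similar_idem (g i) g',
            val g' * val e = val g', val e * val g' = val g' & g' != e]].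

End Idempotents.
Arguments idem0 {A}.
Arguments idem1 {A}.

(* Orthogonality is only required to be preserved in one direction. *)
Definition orthoisomorphism (A B : unitRingType) (t : idem A -> idem B) : Prop :=
  bijective t /\ forall e f, orthogonal_idem e f -> orthogonal_idem (t e) (t f).

Section InducedBijection.
Variable K : numFieldType.

Lemma symmetry_inj (A : unitAlgType K) : injective (@idem_symmetry A).
Proof.
move=> e f /(congr1 val) /= /addrI /oppr_inj ef; apply/val_inj => /=.
have two0 : (2%:R : K) != 0 by rewrite pnatr_eq0.
by apply: (scalerI two0); rewrite !scaler_nat.
Qed.

Lemma symmetry_surj (A : unitAlgType K) (u : GL A) : (u * u = 1)%g ->
  exists e : idem A, idem_symmetry e = u.
Proof.
move=> /(congr1 val) /= uu.
have two0 : (2%:R : K) != 0 by rewrite pnatr_eq0.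
have h : (2%:R^-1 *: (1 - val u)) * (2%:R^-1 *: (1 - val u))
    == 2%:R^-1 *: (1 - val u).
  rewrite -scalerAl -scalerAr; apply/eqP; congr (_ *: _).
  rewrite mulrBr mulr1 mulrBl mul1r uu -(opprB 1) opprK -mulr2n.
  by rewrite -[X in _ *: X]scaler_nat scalerA mulVf ?scale1r.
exists (mkIdem h); apply/val_inj => /=.
by rewrite -scaler_nat scalerA mulfV // scale1r opprB addrC subrK.
Qed.

(* The map theta with 1 - 2 theta e = phi (1 - 2 e) exists, is bijective and is
   unique. *)
Lemma induced_bijection (A B : unitAlgType K)
    (phi : {multiplicative GL A -> GL B}) : bijective phi ->
  exists2 theta : idem A -> idem B, bijective theta &
    forall t : idem A -> idem B,
      (forall e, 1 - val (t e) *+ 2 = val (phi (idem_symmetry e))) <-> t = theta.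
Proof.
move=> [psi phiK psiK].
have sqr (C : unitAlgType K) (e : idem C) : (idem_symmetry e * idem_symmetry e = 1)%g.
  exact/val_inj/symmetry_sqr.
have phiE u : (u * u = 1)%g -> (phi u * phi u = 1)%g.
  by move=> uu; rewrite -gmulfM uu; apply: (mulgI (phi 1%g)); rewrite -gmulfM !mulg1.
have psiE v : (v * v = 1)%g -> (psi v * psi v = 1)%g.
  move=> vv; apply: (can_inj phiK); rewrite gmulfM psiK vv.
  by apply: (mulgI (phi 1%g)); rewrite -gmulfM !mulg1.
have /choice[theta thetaE] : forall e, exists f, idem_symmetry f = phi (idem_symmetry e).
  by move=> e; apply/symmetry_surj/phiE/sqr.
have /choice[theta' thetaE'] : forall e, exists f, idem_symmetry f = psi (idem_symmetry e).
  by move=> e; apply/symmetry_surj/psiE/sqr.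
exists theta.
  exists theta' => e; apply: symmetry_inj.
    by rewrite thetaE' thetaE phiK.
  by rewrite thetaE thetaE' psiK.
move=> t; split=> [tE | -> e]; last by rewrite -thetaE.
apply/funext => e; apply/symmetry_inj/val_inj.
by rewrite /= tE -thetaE.
Qed.

End InducedBijection.

(* Main.v *)
Require Import Defs.
From HB Require Import structures.
From mathcomp Require Import all_boot all_order all_algebra.
From mathcomp Require Import all_classical all_reals all_analysis.
From mathcomp Require Import complex.
Set Implicit Arguments.
Unset Strict Implicit.
Unset Printing Implicit Defensive.
Import Order.TTheory GRing.Theory Num.Theory.
Import numFieldNormedType.Exports.
Local Open Scope classical_set_scope.
Local Open Scope ring_scope.

(* In a simple unital C*-algebra, [x A y = 0] forces [x = 0] or [y = 0]; this
   primeness is all that is used of the analytic structure.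

   If [e] and [f] are orthogonal, the element [y] with
   [theta y = theta e * theta f] commutes with every unit commuting with [e] and
   [f]; by primeness it lies in the Boolean algebra with atoms [e], [f],
   [1 - e - f]. Hence one of the four products of [theta e] or its complement
   with [theta f] or its complement vanishes: for each partition of [1] into
   three idempotents, [theta] maps the members to the atoms of a Boolean algebra
   up to complements, i.e. up to a sign for each member.

   The sign of [e] does not depend on the partition: if [e = e1 + e2], then in
   the partition [e1, e2, f, 1 - e - f] the sign of [e] is the product of the
   signs of [e1] and [e2], which are already visible in [e1, e2, 1 - e]. So
   complementing [theta] at the idempotents of negative sign preserves
   orthogonality, and the sign is invariant under similarity because it is
   defined by the group structure. *)

(** * Boolean relations between commuting idempotents *)

Section CommutingIdempotents.
Variable S : nzRingType.
Implicit Types a b r x y : S.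

Definition symdiff x y := x * (1 - y) + (1 - x) * y.

(* For commuting idempotents: the Boolean algebra generated by [x] and [y] has
   at most three atoms. *)
Definition noncrossing x y :=
  [\/ x * y = 0, x * y = x, x * y = y | (1 - x) * (1 - y) = 0].

Definition nontrivial x := x <> 0 /\ x <> 1.

Lemma mul_compll x y : (1 - x) * y = y - x * y.
Proof. by rewrite mulrBl mul1r. Qed.

Lemma mul_complr x y : x * (1 - y) = x - x * y.
Proof. by rewrite mulrBr mulr1. Qed.

Lemma compl_comm x y : x * y = y * x -> (1 - x) * y = y * (1 - x).
Proof. by move=> xy; rewrite mul_compll mul_complr xy. Qed.

Lemma complK x : 1 - (1 - x) = x.
Proof. by rewrite opprB addrC subrK. Qed.

Lemma symdiff_compll x y : symdiff (1 - x) y = 1 - symdiff x y.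
Proof.
apply/eqP; rewrite /symdiff complK eq_sym subr_eq eq_sym addrACA.
by rewrite -!mulrDl subrK [x + _]addrC subrK !mul1r subrK.
Qed.

Lemma symdiff_complr x y : symdiff x (1 - y) = 1 - symdiff x y.
Proof.
by rewrite -symdiff_compll /symdiff !complK addrC.
Qed.

Lemma symdiffC x y : x * y = y * x -> symdiff x y = symdiff y x.
Proof. by move=> xy; rewrite /symdiff !mul_compll !mul_complr xy addrC. Qed.

Lemma symdiff_mul0 x y : x * y = 0 -> symdiff x y = x + y.
Proof. by move=> xy; rewrite /symdiff mul_compll mul_complr xy !subr0. Qed.

(** This identity is how multiplicativity of [phi] enters: products of symmetries become symmetric
    differences, which [theta] therefore preserves. *)
Lemma reflection_symdiff x y :
  1 - symdiff x y *+ 2 = (1 - x *+ 2) * (1 - y *+ 2).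
Proof.
have -> : symdiff x y = x + (1 - x *+ 2) * y.
  by rewrite /symdiff mul_complr mul_compll mulrBl mul1r mulrnAl mulr2n opprD
    -addrA; congr (_ + _); rewrite addrCA.
by rewrite mulrnDl opprD addrA [RHS]mulrBr mulr1 mulrnAr.
Qed.

Lemma noncrossing_compll x y : noncrossing x y -> noncrossing (1 - x) y.
Proof.
rewrite /noncrossing complK mul_compll mul_complr mul_compll => -[->|->|->|].
- by constructor 3; rewrite subr0.
- by constructor 4; rewrite subrr.
- by constructor 1; rewrite subrr.
- move=> /eqP; rewrite subr_eq0 => /eqP h; constructor 2.
  have -> : x * y = x - (1 - y) by rewrite h opprB addrC subrK.
  by rewrite opprB addrA [y + _]addrC subrK.
Qed.

Lemma noncrossing_complr x y : noncrossing x y -> noncrossing x (1 - y).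
Proof.
rewrite /noncrossing complK.
case=> h; rewrite mul_complr ?mul_compll.
- by rewrite h subr0; constructor 2.
- by rewrite h subrr; constructor 1.
- by rewrite h subrr; constructor 4.
constructor 3; move: h; rewrite mul_compll mul_complr => /eqP.
by rewrite subr_eq0 => /eqP <-.
Qed.

Lemma compl_nontrivial x : nontrivial x -> nontrivial (1 - x).
Proof.
case=> x0 x1; split=> /eqP; first by rewrite subr_eq0 => /eqP/esym.
by rewrite subr_eq addrC -subr_eq subrr eq_sym => /eqP.
Qed.

(* The shape of three members of a partition of [1] into four idempotents, up
   to complementation. *)
Record generic a b r : Prop := Generic {
  generic_idem : [/\ a * a = a, b * b = b & r * r = r];
  generic_comm : [/\ a * b = b * a, a * r = r * a & b * r = r * b];
  generic_noncrossing : [/\ noncrossing a r, noncrossing b r,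
    noncrossing (symdiff a b) r, noncrossing b (symdiff a r) &
    noncrossing a (symdiff b r)];
  generic_nontrivial : [/\ nontrivial a, nontrivial b & nontrivial r];
  generic_nontrivial2 :
    [/\ nontrivial (symdiff a b), nontrivial (symdiff a r),
     nontrivial (symdiff b r) & nontrivial (symdiff (symdiff a b) r)]
}.

Lemma compl_idem x : x * x = x -> (1 - x) * (1 - x) = 1 - x.
Proof. by move=> xx; rewrite mul_compll mul_complr xx subrr subr0. Qed.

Lemma generic_compl1 a b r : generic a b r -> generic (1 - a) b r.
Proof.
case=> -[aa bb rr] [ab ar br] [nar nbr nabr nbar nab] [pa pb pr] [p1 p2 p3 p4].
split; split; rewrite ?symdiff_compll //; do ?[exact: compl_nontrivial |
  exact: noncrossing_compll | exact: noncrossing_complr | exact: compl_idem |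
  exact: compl_comm].
Qed.

Lemma generic_sym a b r : generic a b r -> generic b a r.
Proof.
case=> -[aa bb rr] [ab ar br] [nar nbr nabr nbar nab] [pa pb pr] [p1 p2 p3 p4].
by split; split; rewrite // (symdiffC (esym ab)).
Qed.

Lemma generic_compl2 a b r : generic a b r -> generic a (1 - b) r.
Proof. by move=> /generic_sym/generic_compl1/generic_sym. Qed.

Lemma generic_compl3 a b r : generic a b r -> generic a b (1 - r).
Proof.
case=> -[aa bb rr] [ab ar br] [nar nbr nabr nbar nab] [pa pb pr] [p1 p2 p3 p4].
split; split; rewrite ?symdiff_complr //; do ?[exact: compl_nontrivial |
  exact: noncrossing_compll | exact: noncrossing_complr | exact: compl_idem |
  by symmetry; apply: compl_comm].
Qed.

(** Were [r] below [a + b], noncrossing with [a] would put [r] under one summand, or over [a], or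
    make [a] and [r] cover 1. Each case collapses to an equality excluded by nontriviality, such as
    [r = a], [r = a + b] or [a + b = 1]. *)
Lemma generic_not_le a b r :
  generic a b r -> a * b = 0 -> symdiff a b * r = r -> False.
Proof.
case=> -[aa bb rr] [ab ar br] [nar nbr _ nbar nab] [[a0 _] [b0 _] [r0 _]]
  [[_ ab1] [ar0 _] [br0 _] [abr0 _]] ab0.
have ba0 : b * a = 0 by rewrite -ab.
have sdxx x : x * x = x -> symdiff x x = 0.
  by move=> xx; rewrite /symdiff mul_compll mul_complr xx subrr addr0.
have sab : symdiff a b = a + b by rewrite symdiff_mul0.
rewrite sab mulrDl => abr.
have ab_r : r <> a + b.
  by move=> rE; apply: abr0; rewrite sab -rE sdxx.
have join1 x y : (1 - x) * (1 - y) = 0 -> x + y = 1 + x * y.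
  move=> /eqP; rewrite mul_compll mul_complr subr_eq0 subr_eq eq_sym => /eqP <-.
  by rewrite addrAC subrK.
have absurd1 : a + b <> 1 by rewrite -sab.
(* The case of [r] orthogonal to the summand [x], hence strictly below [y]: then [y] and [x + r]
   cross. *)
have step x y : x + y <> 1 -> x <> 0 -> y <> 0 -> y * x = 0 -> x * r = 0 ->
  x * r + y * r = r -> r <> y -> noncrossing y (x + r) -> False.
  move=> xy1 x0 y0 yx xr; rewrite xr add0r => yr ry.
  rewrite /noncrossing mulrDr yx add0r yr => -[|//| |].
  - by move=> r00; rewrite r00 in r0.
  - by rewrite -{1}[r]add0r => /addIr/esym.
  - move=> /join1; rewrite mulrDr yx yr add0r addrA => /addIr.
    by rewrite addrC.
have ra : r <> a by move=> rE; apply: ar0; rewrite rE sdxx.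
have rb : r <> b by move=> rE; apply: br0; rewrite rE sdxx.
case: nar => [ar'|ar'|ar'|/join1 ar'].
- by apply: (step a b) => //; rewrite -(symdiff_mul0 ar').
- case: nbr => [br'|br'|br'|/join1 br'].
  + by move: abr; rewrite ar' br' addr0 => /esym.
  + by move: abr; rewrite ar' br' => /esym.
  + by move: abr; rewrite ar' br' -{2}[r]add0r => /addIr.
  + by move: br'; rewrite -{1}abr ar' addrA => /addIr; rewrite addrC.
- have br' : b * r = 0.
    by apply: (addrI r); rewrite addr0 -[RHS]abr ar'.
  by apply: (step b a) => //;
    [rewrite addrC | rewrite addrC | rewrite -(symdiff_mul0 br')].
- have : a + b * r = 1.
    by apply: (addIr (a * r)); rewrite -ar' -addrA [b * r + _]addrC abr.
  move=> abr1; have := congr1 (fun x => b * x) abr1.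
  by rewrite /= mulrDr ba0 add0r mulrA bb mulr1 => br'; rewrite br' in abr1.
Qed.

(** Of the four noncrossing alternatives for [symdiff a b] and [r], [generic_not_le] excludes two:
    one directly, the other after replacing [r] by [1 - r]. *)
Lemma generic_mul0 a b r : generic a b r -> a * b = 0 ->
  symdiff a b * r = 0 \/ symdiff a b * r = symdiff a b.
Proof.
move=> g ab0; have [_ _ [_ _ nabr _ _] _ _] := g.
case: nabr => [||/(generic_not_le g ab0) //|]; [by left|by right|].
rewrite mul_compll => /eqP; rewrite subr_eq0 => /eqP/esym.
by move=> /(generic_not_le (generic_compl3 g) ab0).
Qed.

(* [x] and [y] are both atoms, or both complements of atoms, of the Boolean
   algebra that they generate. *)
Definition even_pair x y := x * y = 0 \/ (1 - x) * (1 - y) = 0.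

Lemma generic_even a b r : generic a b r -> even_pair a b ->
  symdiff a b * r = 0 \/ symdiff a b * r = symdiff a b.
Proof.
move=> g [/(generic_mul0 g)//|].
move/(generic_mul0 (generic_compl1 (generic_compl2 g))).
by rewrite symdiff_compll symdiff_complr complK.
Qed.

(** A noncrossing pair that is not even becomes orthogonal once one suitable member is complemented,
    and this complements [symdiff a b]. *)
Lemma generic_odd a b r : generic a b r -> noncrossing a b -> ~ even_pair a b ->
  (1 - symdiff a b) * r = 0 \/ (1 - symdiff a b) * r = 1 - symdiff a b.
Proof.
move=> g [ab|ab|ab|ab] nev.
- by case: nev; left.
- rewrite -symdiff_complr; apply: generic_mul0 (generic_compl2 g) _.
  by rewrite mul_complr ab subrr.
- rewrite -symdiff_compll; apply: generic_mul0 (generic_compl1 g) _.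
  by rewrite mul_compll ab subrr.
- by case: nev; right.
Qed.

(** If the pair were nested, say [x] below [y], then [y - x = 1 - q] would put [x] below [q]; since
    [q * x] is 0 or [q], this makes [x] equal to 0 or [q]. *)
Lemma even_pair_compl q x y : x * x = x -> y * y = y ->
  q * x = x * q -> q * y = y * q ->
  x * y = y * x -> symdiff x y = 1 - q ->
  x <> 0 -> y <> 0 -> x <> q -> y <> q ->
  q * x = 0 \/ q * x = q -> q * y = 0 \/ q * y = q ->
  noncrossing x y -> even_pair x y.
Proof.
move=> xx yy qx qy xy sd x0 y0 xq yq hx hy.
have key z w : z * z = z -> q * z = z * q -> z <> 0 -> z <> q ->
    q * z = 0 \/ q * z = q -> z * w = z -> w - z = 1 - q -> False.
  move=> zz qz z0 zq hz zw wz.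
  have {}zw : z * q = z.
    by have := congr1 (fun t => z * t) wz; rewrite /= mulrBr mul_complr zw zz
      subrr => /esym/eqP; rewrite subr_eq0 => /eqP.
  by case: hz; rewrite qz zw.
case=> h; [by left| | |by right]; exfalso.
- apply: (key x y) => //.
  by rewrite -sd /symdiff mul_complr mul_compll h subrr add0r.
- apply: (key y x) => //; first by rewrite -xy.
  by rewrite -sd /symdiff mul_complr mul_compll h subrr addr0.
Qed.
End CommutingIdempotents.

Definition prime_ring (S : nzRingType) :=
  forall x y : S, (forall a, x * a * y = 0) -> x = 0 \/ y = 0.

(** * Idempotents and corners of a prime algebra *)

Section Idempotents.
Variables (K : numFieldType) (A : unitAlgType K).
Implicit Types (x y p : A) (e f g : idem A) (u : GL A).

Lemma mulr2_inj : injective (fun x => x *+ 2).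
Proof.
have two0 : (2%:R : K) != 0 by rewrite pnatr_eq0.
by move=> x y xy; apply: (scalerI two0); rewrite !scaler_nat.
Qed.

Lemma comm_symmetry e x :
  val (idem_symmetry e) * x = x * val (idem_symmetry e) <->
  val e * x = x * val e.
Proof.
rewrite /= mulrBl mulrBr mul1r mulr1 mulrnAl mulrnAr; split=> [|->//].
by move=> /addrI/oppr_inj/mulr2_inj.
Qed.

(** The map [phi] sees only units; a square-zero [x] is reached through [1 + x], which commutes with
    the same elements. *)
Lemma unit_add1_sqr0 x : x * x = 0 -> 1 + x \is a GRing.unit.
Proof.
move=> xx; apply/unitrP; exists (1 - x).
by rewrite mulrDr mulr1 mul_compll xx subr0 mulrDl mul1r mul_complr xx subr0
  subrK.
Qed.

(* A nilpotent [n = q x (1 - q)] with [q n = n q] vanishes. *)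
Lemma central_idem q : prime_ring A -> q * q = q ->
  (forall x, q * (q * x * (1 - q)) = q * x * (1 - q) * q) -> q = 0 \/ q = 1.
Proof.
move=> primeA qq qc; have [|//|/eqP] := primeA q (1 - q); [|by left|].
  move=> x; move: (qc x); rewrite !mulrA qq => ->.
  by rewrite -mulrA mul_compll qq subrr mulr0.
by rewrite subr_eq0 => /eqP; right.
Qed.

(* [p y] is a central idempotent of the corner [p A p]. *)
Lemma corner_trivial p y : prime_ring A -> p * p = p -> y * y = y ->
  p * y = y * p ->
  (forall x, x * x = 0 -> p * x = x -> x * p = x -> y * x = x * y) ->
  p * y = 0 \/ p * y = p.
Proof.
move=> primeA pp yy py yc.
have [h hE] : {h : A | h = p * y} by exists (p * y).
have [k kE] : {k : A | k = p - h} by exists (p - h).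
have hy : h * y = h by rewrite hE -mulrA yy.
have yh : y * h = h by rewrite hE py mulrA yy.
have ph : p * h = h by rewrite hE mulrA pp.
have hp : h * p = h by rewrite hE -mulrA -py mulrA pp.
have ky : k * y = 0 by rewrite kE mulrBl hy hE subrr.
have kh : k * h = 0 by rewrite hE py mulrA ky mul0r.
have kp : k * p = k by rewrite kE mulrBl pp hp.
rewrite -hE; have [x||/eqP] := primeA h k; [|by left|]; last first.
  by rewrite kE subr_eq0 => /eqP pE; right; exact/esym.
(* As [k * h = 0], the element [h * x * k] of the corner is square-zero. It is fixed by [y] on the
   left and killed by [y] on the right, so commutation with [y] makes it vanish. *)
have <- : y * (h * x * k) = h * x * k by rewrite !mulrA yh.
rewrite yc.
- by rewrite -mulrA ky mulr0.
- by rewrite !mulrA -[_ * k * h]mulrA kh mulr0 !mul0r.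
- by rewrite !mulrA ph.
- by rewrite -mulrA kp.
Qed.

Lemma orthogonalC e f : orthogonal_idem e f -> orthogonal_idem f e.
Proof. by case=> ef ef0; split; rewrite -ef. Qed.

Lemma idem_sum e f : orthogonal_idem e f ->
  exists g : idem A, val g = val e + val f.
Proof.
case=> ef ef0.
have h : (val e + val f) * (val e + val f) == val e + val f.
  by rewrite mulrDr !mulrDl !idemM -ef ef0 addr0 add0r.
by exists (mkIdem h).
Qed.

Lemma idemCK : involutive (@idemC A).
Proof. by move=> e; apply/val_inj; rewrite /= complK. Qed.

Lemma val_eq0 e : e != idem0 -> val e <> 0.
Proof. by move=> /eqP e0 e0'; apply/e0/val_inj. Qed.

Lemma val_eq1 e : e != idem1 -> val e <> 1.
Proof. by move=> /eqP e1 e1'; apply/e1/val_inj. Qed.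

Lemma orthogonal_neq1 e f : orthogonal_idem e f -> f != idem0 -> e != idem1.
Proof.
move=> [_ ef0] f0; apply/eqP => e1; apply: (val_eq0 f0).
by move: ef0; rewrite e1 /= mul1r.
Qed.

Lemma sum_neq0 e f g : orthogonal_idem e f -> val g = val e + val f ->
  e != idem0 -> g != idem0.
Proof.
move=> [ef ef0] gE e0; apply/eqP => g0; apply: (val_eq0 e0).
have : val g * val e = val e by rewrite gE mulrDl idemM -ef ef0 addr0.
by rewrite g0 /= mul0r.
Qed.

Lemma orthogonal_sum e f g s : orthogonal_idem e g -> orthogonal_idem f g ->
  val s = val e + val f -> orthogonal_idem s g.
Proof.
move=> [eg eg0] [fg fg0] sE.
by split; rewrite sE mulrDl ?mulrDr ?eg ?fg // -eg -fg eg0 fg0 addr0.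
Qed.

Lemma orthogonal_le e f g : val e * val f = val e -> val f * val e = val e ->
  orthogonal_idem f g -> orthogonal_idem e g.
Proof.
move=> ef fe [fg fg0]; have eg0 : val e * val g = 0.
  by rewrite -ef -mulrA fg0 mulr0.
by split; rewrite eg0 // -fe mulrA -fg fg0 mul0r.
Qed.

Definition splits e e1 e2 := [/\ e1 != idem0, e2 != idem0,
  orthogonal_idem e1 e2 & val e = val e1 + val e2].

Lemma splitsC e e1 e2 : splits e e1 e2 -> splits e e2 e1.
Proof. by case=> e1_0 e2_0 /orthogonalC o12 eE; split; rewrite // addrC. Qed.

Lemma splits_orthogonal e e1 e2 f : splits e e1 e2 -> orthogonal_idem e f ->
  orthogonal_idem e1 f.
Proof.
case=> _ _ [e12 e12_0] eE; apply: orthogonal_le; rewrite eE.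
  by rewrite mulrDr idemM e12_0 addr0.
by rewrite mulrDl idemM -e12 e12_0 addr0.
Qed.

Lemma orthogonal_compl e : orthogonal_idem e (idemC e).
Proof. by split; rewrite /= mul_complr ?mul_compll idemM // subrr. Qed.

Lemma orthogonal_sum1 e f : val e + val f = 1 -> f = idemC e.
Proof. by move=> ef; apply/val_inj; rewrite /= -ef [val e + _]addrC addrK. Qed.

(** * Conjugation and similarity *)

Lemma valGL_unit u : val u \is a GRing.unit.
Proof. exact: Defs.GL_unit. Qed.

Lemma conj_mul u x y : val u * x * (val u)^-1 * (val u * y * (val u)^-1) =
  val u * (x * y) * (val u)^-1.
Proof. by rewrite !mulrA mulrVK ?valGL_unit. Qed.

Lemma conj_idem u e : exists f, val f = val u * val e * (val u)^-1.
Proof.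
have h : val u * val e * (val u)^-1 * (val u * val e * (val u)^-1) ==
    val u * val e * (val u)^-1.
  by rewrite conj_mul idemM.
by exists (mkIdem h).
Qed.

Lemma conj_inj u x y : val u * x * (val u)^-1 = val u * y * (val u)^-1 -> x = y.
Proof.
by move=> /(mulIr _)/(mulrI _); apply; rewrite ?unitrV valGL_unit.
Qed.

Lemma conj_compl u x :
  1 - val u * x * (val u)^-1 = val u * (1 - x) * (val u)^-1.
Proof. by rewrite mulrBr mulr1 mulrBl divrr ?valGL_unit. Qed.

Lemma even_pair_conj u x y : even_pair x y ->
  even_pair (val u * x * (val u)^-1) (val u * y * (val u)^-1).
Proof.
by case=> xy; [left|right]; rewrite ?conj_compl conj_mul xy mulr0 mul0r.
Qed.

Lemma splits_conj u e e1 e2 f f1 f2 : splits e e1 e2 ->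
  val f = val u * val e * (val u)^-1 ->
  val f1 = val u * val e1 * (val u)^-1 ->
  val f2 = val u * val e2 * (val u)^-1 -> splits f f1 f2.
Proof.
have nz g h : g != idem0 -> val h = val u * val g * (val u)^-1 -> h != idem0.
  move=> g0 hE; apply/eqP => h0; apply/(val_eq0 g0)/(@conj_inj u).
  by rewrite mulr0 mul0r -hE h0.
case=> /nz n1 /nz n2 [e12 e12_0] eE fE f1E f2E.
split; [exact: n1|exact: n2| |].
  by split; rewrite f1E f2E !conj_mul -?e12 e12_0 // mulr0 mul0r.
by rewrite fE f1E f2E eE mulrDr mulrDl.
Qed.

Lemma similar_sym e f : similar_idem e f -> similar_idem f e.
Proof.
move=> [u fE]; exists (GL_inv u); rewrite fE /= invrK !mulrA.
by rewrite mulVr ?valGL_unit // mul1r mulrVK ?valGL_unit.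
Qed.

Lemma similar_compl e f : similar_idem e f -> similar_idem (idemC e) (idemC f).
Proof. by move=> [u fE]; exists u; rewrite /= fE conj_compl. Qed.

Lemma similar_nontrivial e f : similar_idem e f -> nontrivial_idem e ->
  nontrivial_idem f.
Proof.
move=> ef [e0 e1]; have [u eE] := similar_sym ef.
split; [move: e0|move: e1]; apply: contra => /eqP f_eq; apply/eqP/val_inj.
  by rewrite eE f_eq /= mulr0 mul0r.
by rewrite eE f_eq /= mulr1 divrr ?valGL_unit.
Qed.

Lemma nontrivial_compl e : nontrivial_idem e -> nontrivial_idem (idemC e).
Proof.
move=> [/val_eq0 e0 /val_eq1 e1]; have [c0 c1] := compl_nontrivial (conj e0 e1).
by split; apply/eqP => /(congr1 val).
Qed.

End Idempotents.

(** * The map induced on idempotents by a group isomorphism *)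

Section InducedMap.
Variables (K : numFieldType) (A B : unitAlgType K).
Hypotheses (primeA : prime_ring A) (primeB : prime_ring B).
Variables (phi : {multiplicative GL A -> GL B}) (theta : idem A -> idem B).
Hypothesis phi_bij : bijective phi.
Hypothesis thetaE : forall e : idem A,
  1 - val (theta e) *+ 2 = val (phi (idem_symmetry e)).
Implicit Types (e f g : idem A) (u : GL A).

Lemma phi_symmetry e : phi (idem_symmetry e) = idem_symmetry (theta e).
Proof. by apply/val_inj; rewrite -thetaE. Qed.

Lemma theta_bij : bijective theta.
Proof.
by have [t tbij /(_ theta)[/(_ thetaE)->]] := induced_bijection phi_bij.
Qed.

Lemma theta_inj : injective theta.
Proof. exact: bij_inj theta_bij. Qed.

(** Commuting with [e] and with its symmetry is the same, and for units commutation is a group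
    relation, which the bijective [phi] preserves in both directions. *)
Lemma theta_comm u e : val e * val u = val u * val e <->
  val (theta e) * val (phi u) = val (phi u) * val (theta e).
Proof.
have comm_GL (C : unitAlgType K) (v w : GL C) :
    val v * val w = val w * val v <-> (v * w = w * v)%g.
  by split=> [vw|/(congr1 val)//]; apply/val_inj.
rewrite -!comm_symmetry !comm_GL -phi_symmetry -!gmulfM.
by split=> [->//|]; apply: bij_inj.
Qed.

Lemma theta_commute e f : val e * val f = val f * val e ->
  val (theta e) * val (theta f) = val (theta f) * val (theta e).
Proof.
move=> ef; apply/esym/comm_symmetry; rewrite -phi_symmetry.
by apply/esym/theta_comm/esym/comm_symmetry.
Qed.

Lemma theta_symdiff e f g : val g = symdiff (val e) (val f) ->
  val (theta g) = symdiff (val (theta e)) (val (theta f)).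
Proof.
move=> gE; apply/mulr2_inj/oppr_inj/(addrI 1).
rewrite reflection_symdiff !thetaE.
have -> : idem_symmetry g = (idem_symmetry e * idem_symmetry f)%g.
  by apply/val_inj; rewrite /= gE reflection_symdiff.
by rewrite gmulfM.
Qed.

Lemma theta_idem0 : theta idem0 = idem0.
Proof.
apply: (@symmetry_inj K); rewrite -phi_symmetry.
have symm0 (C : unitAlgType K) : idem_symmetry (@idem0 C) = 1%g.
  by apply/val_inj; rewrite /= mul0rn subr0.
by rewrite !symm0; apply: (mulgI (phi 1%g)); rewrite -gmulfM !mulg1.
Qed.

(** The symmetry of 1 is the central element -1, so [theta idem1] commutes with every unit of [B].
    Primeness leaves only 0 and 1, and 0 is already the image of [idem0]. *)
Lemma theta_idem1 : theta idem1 = idem1.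
Proof.
have [psi phiK psiK] := phi_bij.
have cent (v : GL B) : val (theta idem1) * val v = val v * val (theta idem1).
  by rewrite -(psiK v); apply/theta_comm; rewrite /= mul1r mulr1.
have [x|t0|t1] := central_idem primeB (idemM (theta idem1)).
- set q := val _; set n := q * x * (1 - q).
  have nn : n * n = 0.
    by rewrite /n !mulrA -[_ * (1 - _) * _]mulrA mul_compll idemM subrr mulr0
      !mul0r.
  have := cent (mkGL (unit_add1_sqr0 nn)).
  by rewrite /= mulrDr mulrDl mulr1 mul1r => /addrI.
- have : theta idem1 = theta idem0 by rewrite theta_idem0; apply/val_inj.
  by move=> /theta_inj/(congr1 val)/eqP; rewrite /= oner_eq0.
- exact/val_inj.
Qed.

Lemma theta_compl e : theta (idemC e) = idemC (theta e).
Proof.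
have symdiff1 (C : unitAlgType K) (x : C) : symdiff 1 x = 1 - x.
  by rewrite /symdiff subrr mul0r mul1r addr0.
apply/val_inj; rewrite (@theta_symdiff idem1 e) ?theta_idem1 //= symdiff1 //.
Qed.

Lemma theta_sum e f g : orthogonal_idem e f -> val g = val e + val f ->
  val (theta g) = symdiff (val (theta e)) (val (theta f)).
Proof. by case=> _ ef0 gE; apply: theta_symdiff; rewrite gE symdiff_mul0. Qed.

(* [theta y = theta e * theta f] commutes with the centralizer of [e] and [f],
   which forces [y] into the Boolean algebra with atoms [e], [f], [1 - e - f].
   Its eight members rule out a fourth atom [theta e * theta f]. *)
Lemma theta_noncrossing e f : orthogonal_idem e f ->
  noncrossing (val (theta e)) (val (theta f)).
Proof.
move=> oef; have [ef ef0] := oef; have fe0 : val f * val e = 0 by rewrite -ef.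
have qr := theta_commute ef.
have xE : val (theta e) * val (theta f) * (val (theta e) * val (theta f)) ==
    val (theta e) * val (theta f).
  by rewrite {1}qr mulrA -[_ * _ * val (theta e)]mulrA idemM -qr -mulrA idemM.
have [tinv tK tinvK] := theta_bij.
pose y := tinv (mkIdem xE); have ty : theta y = mkIdem xE by rewrite tinvK.
have yc u : val e * val u = val u * val e -> val f * val u = val u * val f ->
    val y * val u = val u * val y.
  move=> /theta_comm eu /theta_comm fu; apply/theta_comm; rewrite ty /=.
  by rewrite -mulrA fu mulrA eu mulrA.
have yidem g : val e * val g = val g * val e -> val f * val g = val g * val f ->
    val g * val y = val y * val g.
  move=> eg fg; apply/comm_symmetry/esym/yc.
    by apply/esym/comm_symmetry.
  by apply/esym/comm_symmetry.
have [s sE] := idem_sum oef.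
(* If [e] and [f] each act as 0 or as the identity on the corner of [g], every element of that
   corner commutes with both, so its square-zero elements commute with [y] and [corner_trivial]
   applies. *)
have corner g : (forall z : idem A, z = e \/ z = f ->
      val z * val g = 0 /\ val g * val z = 0 \/
      val z * val g = val g /\ val g * val z = val g) ->
    val g * val y = 0 \/ val g * val y = val g.
  move=> zg; have zc z : z = e \/ z = f -> val z * val g = val g * val z.
    by move=> /zg[[-> ->]|[-> ->]].
  apply: corner_trivial; rewrite ?idemM //.
    by apply: yidem; apply: zc; [left|right].
  move=> x xx gx xg; have := yc (mkGL (unit_add1_sqr0 xx)).
  have zx z : z = e \/ z = f -> val z * x = x * val z.
    move=> /zg[] [zg1 zg2].
      by rewrite -[in LHS]gx -[in RHS]xg mulrA zg1 -mulrA zg2 mul0r mulr0.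
    by rewrite -[in LHS]gx -[in RHS]xg mulrA zg1 gx -mulrA zg2 xg.
  rewrite /= !mulrDr !mulrDl !mulr1 !mul1r (zx e) ?(zx f); [|by right|by left].
  by move=> /(_ erefl erefl)/addrI.
have ye := corner e; have yf := corner f; have yr := corner (idemC s).
have yE : val y = val e * val y + val f * val y + val (idemC s) * val y.
  by rewrite -!mulrDl /= sE addrC subrK mul1r.
have {ye} ye : val e * val y = 0 \/ val e * val y = val e.
  by apply: ye => z [->|->]; [right|left]; rewrite ?idemM.
have {yf} yf : val f * val y = 0 \/ val f * val y = val f.
  by apply: yf => z [->|->]; [left|right]; rewrite ?idemM.
have {yr} yr : val (idemC s) * val y = 0 \/ val (idemC s) * val y = val (idemC s).
  apply: yr => z zef; left; rewrite /= mul_complr mul_compll sE mulrDr mulrDl.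
  by case: zef => ->; rewrite idemM ?ef0 ?fe0 ?addr0 ?add0r subrr.
have ts := theta_sum oef sE.
have yval g : val y = val g -> val (theta e) * val (theta f) = val (theta g).
  by move=> /val_inj <-; rewrite ty.
have qq := idemM (theta e); have rr := idemM (theta f).
(* Eight cases, one for each set of atoms summing to [y]. Sets of at most one atom give the four
   noncrossing alternatives. For two atoms, [theta e * theta f] equals an element orthogonal to it
   and so vanishes. For all three it is 1, whence it equals [theta e]. *)
move: yE; case: ye => ->; case: yf => ->; case: yr => ->;
  rewrite ?(add0r, addr0).
- by move=> /(yval idem0) qr0; constructor 1; rewrite qr0 theta_idem0.
- move=> /yval; rewrite theta_compl /= ts -symdiff_compll /symdiff complK.
  by rewrite -{1}[_ * val (theta f)]add0r => /addIr/esym; constructor 4.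
- by move=> /yval; constructor 3.
- have -> : val f + val (idemC s) = val (idemC e).
    by rewrite /= sE [val e + _]addrC opprD addrCA addNKr.
  move=> /yval; rewrite theta_compl /= => qrE; constructor 1.
  by rewrite -{1}qq -mulrA qrE mul_complr qq subrr.
- by move=> /yval; constructor 2.
- have -> : val e + val (idemC s) = val (idemC f).
    by rewrite /= sE opprD addrCA addNKr.
  move=> /yval; rewrite theta_compl /= => qrE; constructor 1.
  by rewrite -{1}rr mulrA qrE mul_compll rr subrr.
- rewrite -sE => /yval; rewrite ts => qrE; constructor 1.
  have := congr1 (fun t => val (theta e) * t) qrE.
  rewrite /= mulrDr !mulrA qq mul_complr mul_complr qq subrr mul0r addr0.
  move=> /(congr1 (fun t => t * val (theta f))).
  by rewrite /= mulrBl -mulrA rr subrr.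
- have -> : val e + val f + val (idemC s) = val idem1.
    by rewrite /= sE addrC subrK.
  move=> /yval; rewrite theta_idem1 => qrE; constructor 2.
  by rewrite -[RHS]mulr1 -[X in _ = _ * X]qrE mulrA qq.
Qed.

Lemma theta_nontrivial e : e != idem0 -> e != idem1 -> nontrivial (val (theta e)).
Proof.
move=> e0 e1; split; [apply: val_eq0|apply: val_eq1].
  by rewrite -theta_idem0 (inj_eq theta_inj).
by rewrite -theta_idem1 (inj_eq theta_inj).
Qed.

(** The condition on the sum makes the fourth member of the partition nonzero, so all the partial
    sums involved are nontrivial. [theta] turns these sums into symmetric differences, and
    [theta_noncrossing] applies to disjoint ones. *)
Lemma theta_generic e1 e2 f : e1 != idem0 -> e2 != idem0 -> f != idem0 ->
  orthogonal_idem e1 e2 -> orthogonal_idem e1 f -> orthogonal_idem e2 f ->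
  val e1 + val e2 + val f <> 1 ->
  generic (val (theta e1)) (val (theta e2)) (val (theta f)).
Proof.
move=> n1 n2 nf o12 o1f o2f sum1.
have [s12 s12E] := idem_sum o12; have [s1f s1fE] := idem_sum o1f.
have [s2f s2fE] := idem_sum o2f.
have os12f := orthogonal_sum o1f o2f s12E.
have os1f2 := orthogonal_sum o12 (orthogonalC o2f) s1fE.
have os2f1 := orthogonal_sum (orthogonalC o12) (orthogonalC o1f) s2fE.
have [s sE] := idem_sum os12f.
have ns12 := sum_neq0 o12 s12E n1.
split.
- by rewrite !idemM.
- by split; apply: theta_commute; [case: o12|case: o1f|case: o2f].
- by split; rewrite -?(theta_sum o12 s12E) -?(theta_sum o1f s1fE)
    -?(theta_sum o2f s2fE); apply: theta_noncrossing => //; apply: orthogonalC.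
- split; apply: theta_nontrivial => //; [exact: orthogonal_neq1 o12 _|
    exact: orthogonal_neq1 o2f _|exact: orthogonal_neq1 (orthogonalC o1f) _].
- split; rewrite -?(theta_sum o12 s12E) -?(theta_sum o1f s1fE)
    -?(theta_sum o2f s2fE) -?(theta_sum os12f sE); apply: theta_nontrivial => //.
  + exact: orthogonal_neq1 os12f _.
  + exact: sum_neq0 o1f s1fE _.
  + exact: orthogonal_neq1 os1f2 _.
  + exact: sum_neq0 o2f s2fE _.
  + exact: orthogonal_neq1 os2f1 _.
  + exact: sum_neq0 os12f sE _.
  + by apply/eqP => s1; apply: sum1; rewrite -s12E -sE s1.
Qed.

Lemma splits_generic e e1 e2 f : splits e e1 e2 -> orthogonal_idem e f ->
  f != idem0 -> val e + val f <> 1 ->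
  generic (val (theta e1)) (val (theta e2)) (val (theta f)).
Proof.
move=> e12 ef f0 ef1; have [e1_0 e2_0 o12 eE] := e12.
apply: theta_generic; rewrite -?eE //; first exact: splits_orthogonal e12 ef.
exact: splits_orthogonal (splitsC e12) ef.
Qed.

(* The sign of [e]: it is even when [theta e] rather than its complement is the
   correct image of [e]. *)
Definition even_idem e :=
  exists e1 e2, splits e e1 e2 /\ even_pair (val (theta e1)) (val (theta e2)).

(** Splitting [e] makes [e1], [e2], [f] three members of a four-part partition of 1, so the sign
    read off from [e1] and [e2] governs how [theta e] meets [theta f]. *)
Lemma theta_even e f : even_idem e -> orthogonal_idem e f -> f != idem0 ->
  val e + val f <> 1 -> val (theta e) * val (theta f) = 0 \/
    val (theta e) * val (theta f) = val (theta e).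
Proof.
move=> [e1 [e2 [e12 ev]]] ef f0 ef1; have [_ _ o12 eE] := e12.
rewrite (theta_sum o12 eE); apply: generic_even ev.
exact: splits_generic e12 ef f0 ef1.
Qed.

Lemma theta_odd e f : (exists e1 e2, splits e e1 e2) -> ~ even_idem e ->
  orthogonal_idem e f -> f != idem0 -> val e + val f <> 1 ->
  (1 - val (theta e)) * val (theta f) = 0 \/
  (1 - val (theta e)) * val (theta f) = 1 - val (theta e).
Proof.
move=> [e1 [e2 e12]] odd ef f0 ef1; have [_ _ o12 eE] := e12.
rewrite (theta_sum o12 eE); apply: generic_odd.
- exact: splits_generic e12 ef f0 ef1.
- exact: theta_noncrossing.
- by move=> ev; apply: odd; exists e1, e2.
Qed.

(** * Invariance of the sign, and the sign-corrected map *)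

Hypothesis split_idem : forall e, nontrivial_idem e ->
  exists e1 e2, splits e e1 e2.

(** In a splitting of [1 - e] each half is orthogonal to [e] without completing it to 1, so
    [theta_even] controls both halves, and [even_pair_compl] then rules out that their images are
    nested. *)
Lemma even_compl e : nontrivial_idem e -> even_idem e -> even_idem (idemC e).
Proof.
move=> ne ev; have [f1 [f2 f12]] := split_idem (nontrivial_compl ne).
exists f1, f2; split=> //.
have key g h : splits (idemC e) g h ->
    [/\ orthogonal_idem e g, val (theta g) <> 0, val (theta g) <> val (theta e) &
    val (theta e) * val (theta g) = 0 \/
    val (theta e) * val (theta g) = val (theta e)].
  move=> gh; have [g0 h0 [_ gh0] cE] := gh.
  have eg : orthogonal_idem e g.
    exact/orthogonalC/(splits_orthogonal gh)/orthogonalC/orthogonal_compl.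
  split=> //.
  - by apply: val_eq0; rewrite -theta_idem0 (inj_eq theta_inj).
  - move=> /val_inj/theta_inj ge; apply: (val_eq0 g0).
    by case: eg; rewrite ge idemM.
  - apply: theta_even => // /orthogonal_sum1 gE; apply: (val_eq0 h0).
    by apply: (addrI (val g)); rewrite -cE gE addr0.
have [ef1 f1_0 f1e hf1] := key _ _ f12.
have [ef2 f2_0 f2e hf2] := key _ _ (splitsC f12).
have [_ _ of12 cE] := f12.
apply: (even_pair_compl (q := val (theta e))); rewrite ?idemM //.
- by apply: theta_commute; case: ef1.
- by apply: theta_commute; case: ef2.
- by apply: theta_commute; case: of12.
- by rewrite -(theta_sum of12 cE) theta_compl.
- exact: theta_noncrossing.
Qed.

(** Conjugacy by [u] is the group relation saying that [u] intertwines the two symmetries, so [phi]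
    transports it. *)
Lemma theta_conj u e f : val f = val u * val e * (val u)^-1 ->
  val (theta f) = val (phi u) * val (theta e) * (val (phi u))^-1.
Proof.
move=> fE; have : (idem_symmetry f * u = u * idem_symmetry e)%g.
  apply/val_inj; rewrite /= fE mulrBl mulrBr mul1r mulr1 mulrnAl mulrnAr.
  by rewrite mulrVK ?valGL_unit.
move=> /(congr1 phi); rewrite !gmulfM !phi_symmetry => /(congr1 val).
rewrite /= mulrBl mulrBr mul1r mulr1 mulrnAl mulrnAr.
by move=> /addrI/oppr_inj/mulr2_inj <-; rewrite mulrK ?valGL_unit.
Qed.

Lemma even_similar e f : similar_idem e f -> even_idem e -> even_idem f.
Proof.
move=> [u fE] [e1 [e2 [e12 ev]]].
have [f1 f1E] := conj_idem u e1; have [f2 f2E] := conj_idem u e2.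
exists f1, f2; split; first exact: splits_conj e12 fE f1E f2E.
by rewrite (theta_conj f1E) (theta_conj f2E); apply: even_pair_conj.
Qed.

(** 0 has no splitting and so is not even; restricting to nontrivial idempotents leaves [theta]
    uncorrected at 0 and 1. *)
Definition odd_idem : set (idem A) :=
  [set e | nontrivial_idem e /\ ~ even_idem e].

Definition signed_theta e :=
  if `[< odd_idem e >] then idemC (theta e) else theta e.

Lemma odd_compl e : odd_idem e -> odd_idem (idemC e).
Proof.
move=> [ne oe]; split; first exact: nontrivial_compl.
by move=> /(even_compl (nontrivial_compl ne)); rewrite idemCK.
Qed.

Lemma odd_complE e : odd_idem (idemC e) = odd_idem e.
Proof.
by apply/propext; split=> /odd_compl //; rewrite idemCK.
Qed.

Lemma odd_similar e f : similar_idem e f -> odd_idem e = odd_idem f.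
Proof.
have half e' f' : similar_idem e' f' -> odd_idem e' -> odd_idem f'.
  move=> ef [ne oe]; split; first exact: similar_nontrivial ef ne.
  by move=> /(even_similar (similar_sym ef)).
by move=> ef; apply/propext; split; apply: half; [|apply: similar_sym].
Qed.

Lemma signed_theta_compl e : signed_theta (idemC e) = idemC (signed_theta e).
Proof. by rewrite /signed_theta odd_complE theta_compl; case: ifP. Qed.

Lemma signed_theta0 : signed_theta idem0 = idem0.
Proof.
by rewrite /signed_theta theta_idem0; case: asboolP => // -[[]]; rewrite eqxx.
Qed.

Lemma signed_theta1 : signed_theta idem1 = idem1.
Proof.
by rewrite /signed_theta theta_idem1; case: asboolP => // -[[_]]; rewrite eqxx.
Qed.

Lemma signed_theta_bij : bijective signed_theta.
Proof.
have [tinv tK tinvK] := theta_bij.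
(* The sign is invariant under complementation, so [tinv h] has the sign of the sought preimage
   whether or not [theta] was complemented there. *)
exists (fun h =>
  if `[< odd_idem (tinv h) >] then idemC (tinv h) else tinv h) => x.
  have -> : tinv (signed_theta x) = if `[< odd_idem x >] then idemC x else x.
    by rewrite /signed_theta; case: ifP => _; rewrite -?theta_compl tK.
  by case odd: `[< odd_idem x >]; rewrite ?odd_complE odd ?idemCK.
case odd: `[< odd_idem (tinv x) >];
  rewrite /signed_theta ?odd_complE odd ?tinvK //.
by rewrite theta_compl tinvK idemCK.
Qed.

(** [theta_even] or [theta_odd] gives the alternative with [theta f] as second factor; complementing
    that factor only exchanges the two outcomes. *)
Lemma signed_theta_half e f : nontrivial_idem e -> orthogonal_idem e f ->
  f != idem0 -> val e + val f <> 1 ->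
  val (signed_theta e) * val (signed_theta f) = 0 \/
  val (signed_theta e) * val (signed_theta f) = val (signed_theta e).
Proof.
move=> ne ef f0 ef1.
have h : val (signed_theta e) * val (theta f) = 0 \/
    val (signed_theta e) * val (theta f) = val (signed_theta e).
  rewrite /signed_theta; case: asboolP => [[_ oe]|oe].
    exact: (theta_odd (split_idem ne)).
  by apply: theta_even => //; apply: contrapT => ev; apply: oe.
rewrite {2 4}/signed_theta; case: ifP => // _; rewrite /= !mul_complr.
by case: h => ->; [right; rewrite subr0|left; rewrite subrr].
Qed.

(** Used in both orders, [signed_theta_half] shows that the product is 0 or equals both factors, and
    the latter contradicts injectivity. Pairs with a zero member or with sum 1 are treated first. *)
Lemma signed_theta_orthogonal e f : orthogonal_idem e f ->
  orthogonal_idem (signed_theta e) (signed_theta f).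
Proof.
move=> ef.
have [->|e0] := eqVneq e idem0.
  by rewrite signed_theta0; split; rewrite /= ?mul0r ?mulr0.
have [->|f0] := eqVneq f idem0.
  by rewrite signed_theta0; split; rewrite /= ?mul0r ?mulr0.
have [/orthogonal_sum1 ->|/eqP ef1] := eqVneq (val e + val f) 1.
  by rewrite signed_theta_compl; apply: orthogonal_compl.
have fe := orthogonalC ef.
have ne : nontrivial_idem e by split; last exact: orthogonal_neq1 ef f0.
have nf : nontrivial_idem f by split; last exact: orthogonal_neq1 fe e0.
have comm : val (signed_theta e) * val (signed_theta f) =
    val (signed_theta f) * val (signed_theta e).
  have c := theta_commute ef.1.
  rewrite /signed_theta; case: ifP => _; case: ifP => _ //=.
  - by apply/compl_comm/esym/compl_comm.
  - exact: compl_comm.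
  - exact/esym/compl_comm.
split=> //; have [//|he] := signed_theta_half ne ef f0 ef1.
have [|//|hf] := signed_theta_half nf fe e0; first by rewrite addrC.
  by rewrite comm.
have : signed_theta e = signed_theta f by apply/val_inj; rewrite /= -he comm.
move=> /(bij_inj signed_theta_bij) eqef; case: (val_eq0 e0).
by case: ef => _; rewrite -eqef idemM.
Qed.

Lemma signed_theta_similar e f : similar_idem e f ->
  similar_idem (signed_theta e) (signed_theta f).
Proof.
move=> ef; rewrite /signed_theta (odd_similar ef).
have tef : similar_idem (theta e) (theta f).
  by case: ef => u fE; exists (phi u); apply: theta_conj.
by case: ifP => _ //; apply: similar_compl.
Qed.

End InducedMap.

(** * Primeness of simple C*-algebras *)

Section SimpleCStar.
Variables (R : realType) (A : unitalCStarAlgType R).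

Lemma continuous_mulr (c : A) :
  continuous ((fun x => x * c) : banach A -> banach A).
Proof.
pose f : banach A -> banach A := fun x => (x : A) * c.
have flin : linear f by move=> a x y; rewrite /f mulrDl scalerAl.
pose f_lin := GRing.isLinear.Build R[i] (banach A) (banach A) *:%R f flin.
pose F : {linear banach A -> banach A} := HB.pack f f_lin.
apply: (@bounded_linear_continuous _ _ _ F).
apply/linear_boundedP; exists `|(c : banach A)|; split; first exact: normr_real.
move=> r cr x; apply: (le_trans (anormM x c)); rewrite mulrC.
exact: ler_wpM2r (normr_ge0 x) _ _ (ltW cr).
Qed.

(* The elements [x] with [x A y = 0] form a closed two-sided ideal. *)
Lemma simple_prime : simple_cstar A -> prime_ring A.
Proof.
move=> simpleA x y xy0.
pose I : set A := [set z | forall a, z * a * y = 0].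
have idealI : two_sided_ideal I.
  split=> [a|z w Iz Iw a|b z Iz a|b z Iz a]; first by rewrite !mul0r.
  - by rewrite !mulrDl Iz Iw addr0.
  - by rewrite -!mulrA [z * _]mulrA Iz mulr0.
  - by rewrite -[z * b * a]mulrA Iz.
have closedI : closed (I : set (banach A)).
  have -> : I = \bigcap_(a in [set: A])
      ((fun z => z * (a * y)) : banach A -> banach A) @^-1` [set 0].
    apply/seteqP; split=> z Iz a; first by move=> _ /=; rewrite mulrA Iz.
    by have := Iz a Logic.I; rewrite /= mulrA.
  apply: closed_bigI => a _; apply: preimage_closed.
    by move=> ? _; apply: continuous_mulr.
  exact/accessible_closed_set1/hausdorff_accessible/norm_hausdorff.
have [I0|IT] := simpleA I idealI closedI.
  by left; have : I x by []; rewrite I0.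
right; have : I 1 by rewrite IT.
by move=> /(_ 1); rewrite !mul1r.
Qed.

End SimpleCStar.

(** Odd decomposability with both idempotents equal to [e] writes [e] as a sum of at least three
    orthogonal pieces. The first is split off; the rest is nonzero because the second piece lies
    below it. *)
Lemma oddly_decomposable_splits (K : numFieldType) (A : unitAlgType K)
    (e : idem A) : oddly_decomposable A -> nontrivial_idem e ->
  exists e1 e2, splits e e1 e2.
Proof.
move=> oddA ne.
have [[|[|n]] [g [[_ n3] gn gorth gsum _]]] := oddA e e ne ne => //.
pose i0 : 'I_n.+2 := ord0; pose i1 : 'I_n.+2 := lift ord0 ord0.
have geE i : val (g i) * val e = val (g i) /\ val e * val (g i) = val (g i).
  rewrite -gsum mulr_sumr mulr_suml; split;
    rewrite (bigD1 i) //= idemM big1 ?addr0 //.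
    by move=> j ji; have [] := gorth i j; rewrite // eq_sym.
  by move=> j ji; have [] := gorth j i.
have [ge eg] := geE i0.
have hE : (val e - val (g i0)) * (val e - val (g i0)) == val e - val (g i0).
  by rewrite mulrBr !mulrBl !idemM ge eg subrr subr0.
exists (g i0), (mkIdem hE); split.
- by case: (gn i0).
- apply/eqP => /(congr1 val) /eqP; rewrite subr_eq0 => /eqP e_g0.
  have [/val_eq0 g1_0 _] := gn i1; apply: g1_0.
  have [<- _] := geE i1; have [_ g10] := gorth i1 i0 isT.
  exact: etrans (congr1 _ e_g0) g10.
- by split; rewrite /= ?mulrBr ?mulrBl idemM ge ?eg // subrr.
- by rewrite /= addrC subrK.
Qed.

Theorem theorem2p9 (R : realType) (A B : unitalCStarAlgType R)
    (simpleA : simple_cstar A) (simpleB : simple_cstar B)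
    (phi : {multiplicative GL A -> GL B}) (phi_bij : bijective phi)
    (theta : idem A -> idem B)
    (thetaE : forall e : idem A,
        1 - val (theta e) *+ 2 = val (phi (idem_symmetry e)))
    (oddA : oddly_decomposable A) :
  exists Io Iobar : set (idem A),
    [/\ Io `&` Iobar = set0,
        Io `|` Iobar = @nontrivial_idem A &
        exists ttheta : idem A -> idem B,
          [/\ forall e, Io e -> ttheta e = theta e,
              forall e, Iobar e -> ttheta e = idemC (theta e),
              ttheta idem1 = idem1 /\ ttheta idem0 = idem0,
              orthoisomorphism ttheta &
              forall e f, similar_idem e f -> similar_idem (ttheta e) (ttheta f)]].
Proof.
have primeA := simple_prime simpleA; have primeB := simple_prime simpleB.
have split_idem e := @oddly_decomposable_splits _ A e oddA.
pose odd := odd_idem theta.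
exists (@nontrivial_idem A `\` odd), odd; split.
- by apply/seteqP; split=> e //= [[_ ?]].
- rewrite setUC setDUK //; by move=> e [].
exists (signed_theta theta); split.
- by move=> e [_ ev]; rewrite /signed_theta asboolF.
- by move=> e oe; rewrite /signed_theta asboolT.
- split; first exact: signed_theta1 phi_bij thetaE.
  exact: signed_theta0 thetaE.
- split; first exact: signed_theta_bij phi_bij thetaE split_idem.
  move=> e f; exact: signed_theta_orthogonal phi_bij thetaE split_idem _ _.
- exact: signed_theta_similar thetaE.
Qed.
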